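(* Let $E$ be a truncation closed differential subfield of ${\mathbf k}((t^\Gamma))$. Let $\widehat E$ be the smallest differential subfield of ${\mathbf k}((t^\Gamma))$ that contains $E$ and is closed under $(I-a\partial)^{-1}$ for all $a\in\widehat E$ with $a\prec 1$. Then $\widehat E$ is truncation closed.
   Context: ${\mathbf k}$ is a differential field with derivation $\partial$ (possibly trivial), $\Gamma$ an additive ordered abelian group, and $c:\Gamma\to{\mathbf k}$ an additive map. ${\mathbf k}((t^\Gamma))$ is the Hahn field of series $f=\sum_\gamma f_\gamma t^\gamma$ ($f_\gamma\in{\mathbf k}$) with well-ordered support $\operatorname{supp} f=\{\gamma: f_\gamma\neq0\}$, with valuation $v(f)=\min\operatorname{supp} f$; $f\prec g$ means $v(f)>v(g)$, so $a\prec 1$ means $\operatorname{supp} a\subseteq\Gamma^{>0}$. It is made into a differential field by $\partial(\sum_\gamma f_\gamma t^\gamma)=\sum_\gamma(\partial(f_\gamma)+f_\gamma c(\gamma))t^\gamma$. For $a\prec 1$ the operator $I-a\partial$ ($I$ the identity) is a bijection of ${\mathbf k}((t^\Gamma))$ onto itself, with inverse $(I-a\partial)^{-1}=\sum_n(a\partial)^n$. The truncation of $f$ at $\gamma_0\in\Gamma$ is $f|_{\gamma_0}=\sum_{\gamma<\gamma_0}f_\gamma t^\gamma$; a set is truncation closed if it contains all truncations of its elements. *)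

(* Defs.v *)
From HB Require Import structures.
From mathcomp Require Import all_boot all_order all_algebra.
From mathcomp Require Import ring.
From mathcomp Require Import all_classical.

Set Implicit Arguments.
Unset Strict Implicit.
Unset Printing Implicit Defensive.

Import Order.TTheory GRing.Theory Num.Theory.
Local Open Scope classical_set_scope.
Local Open Scope ring_scope.

HB.mixin Record isOrderedGroup G of Num.POrderedZmodule G := {
  og_comparable : forall x y : G, x >=< y;
  og_leD2l_subproof : forall z x y : G, x <= y -> z + x <= z + y
}.

(* Totality is a field of the mixin, not inherited from [Order.Total]:
   Hierarchy Builder rejects a join of [Order.Total] and [GRing.Zmodule] that
   is not below [Num.RealDomain]. *)
#[short(type="orderedGroupType")]
HB.structure Definition OrderedGroup :=
  { G of Num.POrderedZmodule G & isOrderedGroup G }.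

Section OrderedGroupTheory.
Variable G : orderedGroupType.
Implicit Types x y z : G.

Lemma og_leP x y : Order.le_xor_gt x y (Order.min y x) (Order.min x y)
  (Order.max y x) (Order.max x y) (x <= y) (y < x).
Proof. by apply: comparable_leP; exact: og_comparable. Qed.

Lemma og_leNgt x y : (x <= y) = ~~ (y < x).
Proof. by apply: comparable_leNgt; exact: og_comparable. Qed.

Lemma og_ltNge x y : (x < y) = ~~ (y <= x).
Proof. by apply: comparable_ltNge; exact: og_comparable. Qed.

Lemma og_leD2l z x y : (z + x <= z + y) = (x <= y).
Proof.
apply/idP/idP => [|]; last exact: og_leD2l_subproof.
by move=> /(og_leD2l_subproof (- z)); rewrite !addKr.
Qed.

Lemma og_leD2r z x y : (x + z <= y + z) = (x <= y).
Proof. by rewrite ![_ + z]addrC og_leD2l. Qed.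

Lemma og_leN2 x y : (- x <= - y) = (y <= x).
Proof. by rewrite -(og_leD2l (x + y) (- x)) addrK addrAC subrr add0r. Qed.

Lemma og_ltD2l z x y : (z + x < z + y) = (x < y).
Proof. by rewrite !og_ltNge og_leD2l. Qed.

Lemma og_ltBl x y : (y - x < y) = (0 < x).
by rewrite -(og_ltD2l (x - y) (y - x)) addrA subrK subrr.
Qed.
End OrderedGroupTheory.

Section WellOrdered.
Variable T : orderedGroupType.
Implicit Types A B S : set T.

Definition well_ordered A :=
  forall S, S `<=` A -> S !=set0 -> exists2 m, S m & lbound S m.

Lemma well_orderedS A B : A `<=` B -> well_ordered B -> well_ordered A.
Proof. by move=> AB wB S /subset_trans/(_ AB)/wB. Qed.

Lemma well_orderedU A B :
  well_ordered A -> well_ordered B -> well_ordered (A `|` B).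
Proof.
move=> wA wB S SAB [x Sx].
have [SA|/set0P/negP/negPn/eqP SA0] := pselect (S `&` A !=set0); last first.
  apply: wB; last by exists x.
  move=> y Sy; case: (SAB y Sy) => // Ay.
  by have : (S `&` A) y by []; rewrite SA0.
have [m [Sm Am] mP] := wA (S `&` A) (@subIsetr _ _ _) SA.
have [SB|/set0P/negP/negPn/eqP SB0] := pselect (S `&` B !=set0); last first.
  exists m => // y Sy; case: (SAB y Sy) => [Ay|By]; first exact: mP.
  by have : (S `&` B) y by []; rewrite SB0.
have [n [Sn Bn] nP] := wB (S `&` B) (@subIsetr _ _ _) SB.
have [mn|/ltW nm] := og_leP m n.
- exists m => // y Sy; case: (SAB y Sy) => [Ay|By]; first exact: mP.
  by apply: (le_trans mn); apply: nP.
- exists n => // y Sy; case: (SAB y Sy) => [Ay|By]; last exact: nP.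
  by apply: (le_trans nm); apply: mP.
Qed.

Lemma well_ordered0 : well_ordered set0.
Proof. by move=> S S0 [x /S0]. Qed.

Lemma well_ordered1 (x : T) : well_ordered [set x].
Proof.
move=> S Sx [y Sy]; have yx : y = x by apply: Sx.
by exists y => // z /Sx ->; rewrite yx.
Qed.

Lemma well_ordered_finite A : well_ordered A ->
  (forall S, S `<=` A -> S !=set0 -> exists2 m, S m & ubound S m) ->
  finite_set A.
Proof.
move=> wA wA'; apply: contrapT => infA.
pose I := [set x | A x /\ finite_set (A `&` [set y | y <= x])].
have A0 : A !=set0.
  by apply/set0P/eqP => A0; apply: infA; rewrite A0; exact: finite_set0.
have [m0 Am0 m0P] := wA A (@subset_refl _ _) A0.
have I0 : I !=set0.
  exists m0; split => //; apply: (sub_finite_set _ (finite_set1 m0)).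
  by move=> y [Ay /= ym0]; apply: le_anti; rewrite ym0 m0P.
have [M [AM finM] MP] := wA' I (fun x Ix => Ix.1) I0.
have [|N [AN MN] NP] := wA (A `&` [set y | M < y]) (@subIsetl _ _ _).
  apply: contrapT => /set0P/negP/negPn/eqP AM0; apply: infA.
  apply: (sub_finite_set _ finM) => y Ay; split => //=.
  rewrite og_leNgt; apply/negP => My.
  by have : (A `&` [set y | M < y]) y by []; rewrite AM0.
suff /MP : I N by rewrite og_leNgt MN.
split => //.
apply: (@sub_finite_set _ _ ((A `&` [set y | y <= M]) `|` [set N])).
  move=> y [Ay /= yN]; have [yM|My] := og_leP y M; [by left|right].
  by apply: le_anti; rewrite yN /=; apply: NP.
by rewrite finite_setU; split => //; exact: finite_set1.
Qed.

End WellOrdered.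

Section SumSet.
Variable G : orderedGroupType.
Implicit Types A B S : set G.

Definition sumset A B : set G := [set x | exists a b, [/\ A a, B b & x = a + b]].

Lemma well_ordered_sumset A B :
  well_ordered A -> well_ordered B -> well_ordered (sumset A B).
Proof.
move=> wA wB S SAB S0.
pose has_min X := X !=set0 -> exists2 m : G, X m & lbound X m.
have step (D : set G) : D `<=` A ->
    (forall x, D x -> has_min (S `&` sumset (D `&` [set a | a < x]) B)) ->
    has_min (S `&` sumset D B).
  move=> DA IH [x [Sx [a1 [b1 [Da1 Bb1 ex]]]]]; subst x.
  have [||b0 [Bb0 [a0 [Da0 S00]]] b0P] :=
      wB [set b | B b /\ exists a, D a /\ S (a + b)].
  - by move=> b [].
  - by exists b1; split => //; exists a1.
  have low a b : D a -> B b -> S (a + b) -> a0 <= a -> a0 + b0 <= a + b.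
    move=> Da Bb Sab a0a; apply: (@le_trans _ _ (a0 + b)).
      by rewrite og_leD2l; apply: b0P; split => //; exists a.
    by rewrite og_leD2r.
  have mem0 : (S `&` sumset D B) (a0 + b0) by split => //; exists a0, b0.
  have [E|/set0P/negP/negPn/eqP E] :=
      pselect (S `&` sumset (D `&` [set a | a < a0]) B !=set0); last first.
    exists (a0 + b0) => // x' [Sx' [a [b [Da Bb ex]]]]; subst x'.
    have [a0a|aa0] := og_leP a0 a; first exact: low.
    have : (S `&` sumset (D `&` [set a | a < a0]) B) (a + b).
      by split => //; exists a, b.
    by rewrite E.
  have [m [Sm [a' [b' [[Da' _] Bb' em]]]] mP] := IH a0 Da0 E.
  have memm : (S `&` sumset D B) m by split => //; exists a', b'.
  have lowm a b : D a -> B b -> S (a + b) -> a < a0 -> m <= a + b.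
    by move=> Da Bb Sab aa0; apply: mP; split => //; exists a, b.
  have [mn|/ltW nm] := og_leP m (a0 + b0).
  - exists m => // x' [Sx' [a [b [Da Bb ex]]]]; subst x'.
    have [a0a|aa0] := og_leP a0 a; last exact: lowm.
    by apply: (le_trans mn); exact: low.
  - exists (a0 + b0) => // x' [Sx' [a [b [Da Bb ex]]]]; subst x'.
    have [a0a|aa0] := og_leP a0 a; first exact: low.
    by apply: (le_trans nm); exact: lowm.
have smaller x : A x -> has_min (S `&` sumset (A `&` [set a | a < x]) B).
  move=> Ax; apply: contrapT => bad.
  have [||y [Ay ybad] yP] :=
      wA [set x | A x /\ ~ has_min (S `&` sumset (A `&` [set a | a < x]) B)].
  - by move=> z [].
  - by exists x.
  apply: ybad; apply: step => [z []//|z [Az /= zy]].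
  have -> : A `&` [set a | a < y] `&` [set a | a < z] = A `&` [set a | a < z].
    rewrite -setIA; congr (_ `&` _); apply/seteqP; split => [a []//|a /= az].
    by split => //; apply: lt_trans zy.
  apply: contrapT => zbad; suff: y <= z by rewrite og_leNgt zy.
  exact: yP.
have SI : S `&` sumset A B = S by apply/setIidPl.
by rewrite -SI in S0 *; apply: step.
Qed.

Lemma finite_sumset_fiber A B x : well_ordered A -> well_ordered B ->
  finite_set (A `&` [set a | B (x - a)]).
Proof.
move=> wA wB; apply: well_ordered_finite.
  by apply: well_orderedS wA; exact: subIsetl.
move=> S SAB [s Ss].
have [||_ [m Sm <-] mP] := wB [set x - a | a in S].
- by move=> _ [a Sa <-]; case: (SAB a Sa).
- by exists (x - s), s.
exists m => // a Sa; have : x - m <= x - a by apply: mP; exists a.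
by rewrite og_leD2l og_leN2.
Qed.

End SumSet.

Section HahnSeries.
Variables (k : fieldType) (G : orderedGroupType).

Definition fsupp (f : G -> k) : set G := [set x | f x != 0].

Record hahn := Hahn { coef :> G -> k; supp_wo : well_ordered (fsupp coef) }.
Arguments supp_wo : clear implicits.

Definition supp (f : hahn) : set G := fsupp f.

Lemma hahnP (f g : hahn) : f =1 g -> f = g.
Proof.
case: f g => [f fP] [g gP] /= /funext fg; subst g; congr Hahn.
exact: Prop_irrelevance.
Qed.

HB.instance Definition _ := gen_eqMixin hahn.
HB.instance Definition _ := gen_choiceMixin hahn.

Lemma hahn_notin (f : hahn) x : ~ supp f x -> f x = 0.
Proof. by move=> /negP/negPn/eqP. Qed.

Lemma zero_wo : well_ordered (fsupp (fun=> 0)).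
Proof. by apply: (well_orderedS _ (@well_ordered0 G)); move=> x; rewrite /fsupp /= eqxx. Qed.
Definition hahn_zero := Hahn (@zero_wo).

Lemma opp_wo (f : hahn) : well_ordered (fsupp (fun x => - f x)).
Proof. by apply: (well_orderedS _ (supp_wo f)) => x; rewrite /fsupp /= oppr_eq0. Qed.
Definition hahn_opp f := Hahn (@opp_wo f).

Lemma add_wo (f g : hahn) : well_ordered (fsupp (fun x => f x + g x)).
Proof.
apply: (well_orderedS _ (well_orderedU (supp_wo f) (supp_wo g))) => x.
rewrite /fsupp /setU /=; case: (eqVneq (f x) 0) => [->|_ _]; last by left.
by rewrite add0r; right.
Qed.
Definition hahn_add f g := Hahn (@add_wo f g).

Lemma hahn_addA : associative hahn_add.
Proof. by move=> f g h; apply: hahnP => x /=; rewrite addrA. Qed.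
Lemma hahn_addC : commutative hahn_add.
Proof. by move=> f g; apply: hahnP => x /=; rewrite addrC. Qed.
Lemma hahn_add0 : left_id hahn_zero hahn_add.
Proof. by move=> f; apply: hahnP => x /=; rewrite add0r. Qed.
Lemma hahn_addN : left_inverse hahn_zero hahn_opp hahn_add.
Proof. by move=> f; apply: hahnP => x /=; rewrite addNr. Qed.

HB.instance Definition _ :=
  GRing.isZmodule.Build hahn hahn_addA hahn_addC hahn_add0 hahn_addN.

Lemma coef0 x : (0 : hahn) x = 0. Proof. by []. Qed.
Lemma coefD (f g : hahn) x : (f + g) x = f x + g x. Proof. by []. Qed.
Lemma coefN (f : hahn) x : (- f) x = - f x. Proof. by []. Qed.
Lemma coefB (f g : hahn) x : (f - g) x = f x - g x. Proof. by []. Qed.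

(* A [\sum_(_ \in _)] with infinite support would be 0 by convention; here only
   finitely many terms are nonzero, see [fiber_finite]. *)
Definition conv (f g : hahn) (x : G) : k := \sum_(y \in [set: G]) f y * g (x - y).

Definition fiber (f g : hahn) x : set G := supp f `&` [set y | supp g (x - y)].

Lemma fiber_finite f g x : finite_set (fiber f g x).
Proof. by apply: finite_sumset_fiber; exact: supp_wo. Qed.

Lemma convE f g x (X : set G) : fiber f g x `<=` X ->
  conv f g x = \sum_(y \in X) f y * g (x - y).
Proof.
move=> sX; apply/esym/fsbig_widen => // y [_ Xy] /=.
apply/eqP; rewrite mulf_eq0; apply/negPn/negP; rewrite negb_or => /andP[fy gy].
by apply: Xy; apply: sX.
Qed.

Lemma conv_supp f g : fsupp (conv f g) `<=` sumset (supp f) (supp g).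
Proof.
move=> x; apply: contraPP => Nx; rewrite /fsupp /=; apply/negP/negPn/eqP.
apply: fsbig1 => y _; apply/eqP; rewrite mulf_eq0; apply/negPn/negP.
rewrite negb_or => /andP[fy gy]; apply: Nx; exists y, (x - y).
by split => //; rewrite addrC subrK.
Qed.

Lemma conv_wo f g : well_ordered (fsupp (conv f g)).
Proof.
apply: well_orderedS (@conv_supp f g) _ => /=.
by apply: well_ordered_sumset; exact: supp_wo.
Qed.
Definition hahn_mul f g := Hahn (@conv_wo f g).

(* [c t^x] *)
Lemma mono_wo (c : k) (x : G) : well_ordered (fsupp (fun y => if y == x then c else 0)).
Proof.
apply: (well_orderedS _ (@well_ordered1 G x)) => y; rewrite /fsupp /=.
by case: (y =P x) => // _; rewrite eqxx.
Qed.
Definition mono c x := Hahn (@mono_wo c x).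

Lemma conv_mono c x f y : conv (mono c x) f y = c * f (y - x).
Proof.
rewrite (@convE _ _ _ [set x]) ?fsbig_set1 /= ?eqxx // => z [].
by rewrite /supp /fsupp /=; case: (z =P x) => // _; rewrite eqxx.
Qed.

Lemma subr_bij (x : G) : bijective (fun y => x - y).
Proof. by exists (fun y => x - y) => y; rewrite opprB addrC subrK. Qed.

Lemma addr_bij (x : G) : bijective (fun y => y - x).
Proof. by exists (fun y => y + x) => y; rewrite ?addrK ?subrK. Qed.

Lemma hahn_mulC : commutative hahn_mul.
Proof.
move=> f g; apply: hahnP => x /=; rewrite /conv.
rewrite (reindex_fsbigT _ _ (subr_bij x)); apply: eq_fsbigr => y _.
by rewrite mulrC opprB addrC subrK.
Qed.

Lemma hahn_mul1 : left_id (mono 1 0) hahn_mul.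
Proof. by move=> f; apply: hahnP => x /=; rewrite conv_mono mul1r subr0. Qed.

Lemma hahn_mulDl : left_distributive hahn_mul +%R.
Proof.
move=> f g h; apply: hahnP => x; rewrite coefD /=.
pose X := fiber f h x `|` fiber g h x `|` fiber (f + g) h x.
have finX : finite_set X by rewrite !finite_setU; do !split; exact: fiber_finite.
rewrite !(@convE _ _ _ X) => [|y yX|y yX|y yX]; last 3 first.
- by left; right.
- by left; left.
- by right.
by rewrite -fsbig_split //=; apply: eq_fsbigr => y _; rewrite mulrDl.
Qed.

Lemma hahn_mulA : associative hahn_mul.
Proof.
move=> f g h; apply: hahnP => x /=.
pose X := fiber f (hahn_mul g h) x `|`
  (supp f `&` [set y | sumset (supp g) (supp h) (x - y)]).
pose Y := fiber (hahn_mul f g) h x `|`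
  (sumset (supp f) (supp g) `&` [set y | supp h (x - y)]).
have wo := supp_wo.
have finX : finite_set X.
  rewrite finite_setU; split; first exact: fiber_finite.
  exact: (@finite_sumset_fiber G _ _ _ (wo f) (@well_ordered_sumset G _ _ (wo g) (wo h))).
have finY : finite_set Y.
  rewrite finite_setU; split; first exact: fiber_finite.
  exact: (@finite_sumset_fiber G _ _ _ (@well_ordered_sumset G _ _ (wo f) (wo g)) (wo h)).
rewrite (@convE _ _ _ X) ?(@convE _ _ _ Y); try by move=> y; left.
pose F y z := f y * (g (z - y) * h (x - z)).
transitivity (\sum_(y \in X) \sum_(z \in Y) F y z).
  apply: eq_fsbigr => y _ /=.
  have [fy0|fy] := eqVneq (f y) 0.
    by rewrite fy0 mul0r fsbig1 // => z _; rewrite /F fy0 mul0r.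
  rewrite -fsbig_distrr //; congr (_ * _).
  rewrite /conv (reindex_fsbigT _ _ (addr_bij y)).
  under eq_fsbigr do rewrite opprB addrA subrK.
  apply/esym/fsbig_widen => // z [_ Yz] /=.
  apply/eqP; rewrite mulf_eq0; apply/negPn/negP.
  rewrite negb_or => /andP[gz hz]; apply: Yz; right; split => //.
  by exists y, (z - y); split => //; rewrite addrC subrK.
rewrite exchange_fsbig //; apply: eq_fsbigr => z _.
have [hz0|hz] := eqVneq (h (x - z)) 0.
  by rewrite hz0 mulr0 fsbig1 // => y _; rewrite /F hz0 !mulr0.
under eq_fsbigr do rewrite /F mulrA mulrC.
rewrite -fsbig_distrr // [RHS]mulrC; congr (_ * _).
apply/esym/convE => y [fy gy]; right; split => //.
exists (z - y), (x - z); split => //.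
by rewrite [RHS]addrC addrA subrK.
Qed.

Lemma hahn_oner_neq0 : mono 1 0 != 0.
Proof.
by apply/eqP => /(congr1 (fun f : hahn => f 0)) /= /eqP; rewrite eqxx oner_eq0.
Qed.

HB.instance Definition _ := GRing.Zmodule_isComNzRing.Build hahn
  hahn_mulA hahn_mulC hahn_mul1 hahn_mulDl hahn_oner_neq0.

Lemma coefM (f g : hahn) x : (f * g) x = \sum_(y \in [set: G]) f y * g (x - y).
Proof. by []. Qed.
Lemma coef1 x : (1 : hahn) x = if x == 0 then 1 else 0. Proof. by []. Qed.
Lemma coef_monoM c x (f : hahn) y : (mono c x * f) y = c * f (y - x).
Proof. exact: conv_mono. Qed.

Definition agree_below (f g : hahn) (x : G) := forall y, y < x -> f y = g y.

Lemma diff_min (f g : hahn) x : f x != g x ->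
  exists y, [/\ y <= x, f y != g y & agree_below f g y].
Proof.
move=> fgx.
have [||y /= fgy yP] := @well_orderedU _ _ _ (supp_wo f) (supp_wo g) [set y | f y != g y].
- move=> y /=; rewrite /fsupp /setU /=; case: (eqVneq (f y) 0) => [->|_ _]; last by left.
  by rewrite eq_sym; right.
- by exists x.
exists y; split => //; first exact: yP.
by move=> z; apply: contraTeq => /yP; rewrite og_leNgt.
Qed.

Definition contraction (T : hahn -> hahn) :=
  forall f g x, agree_below f g x -> (T f) x = (T g) x.

Lemma contraction_uniq T f g : contraction T -> T f = f -> T g = g -> f = g.
Proof.
move=> cT Tf Tg; apply: hahnP => x; apply/eqP/negPn/negP => /diff_min[y [_ + fgy]].
by rewrite -Tf -Tg (cT _ _ _ fgy) eqxx.
Qed.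

Lemma contraction_fixpoint T : contraction T -> exists f, T f = f.
Proof.
move=> cT.
pose good x (h : hahn) := forall y, y <= x -> (T h) y = h y.
have coh x x' h h' : good x h -> good x' h' -> forall y, y <= x -> y <= x' -> h y = h' y.
  move=> gh gh' y yx yx'; apply/eqP/negPn/negP => /diff_min[z [zy + hh']].
  by rewrite -gh ?(le_trans zy) // -gh' ?(le_trans zy) // (cT _ _ _ hh') eqxx.
pose I := [set x | exists h, good x h].
pose H x := xget 0 (good x).
have HP x : I x -> good x (H x) by move=> [h hP]; apply: xgetI hP.
have Idown x y : y <= x -> I x -> I y.
  by move=> yx [h hP]; exists h => z zy; apply: hP; apply: le_trans yx.
pose g0 x := if x \in I then H x x else 0.
have g0H x y : I x -> y <= x -> g0 y = H x y.
  move=> Ix yx; have Iy := Idown _ _ yx Ix.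
  by rewrite /g0 mem_set //; apply: (coh y x) => //; apply: HP.
have g0_wo : well_ordered (fsupp g0).
  move=> S Sg [x Sx].
  have Ix : I x.
    by move: (Sg _ Sx); rewrite /fsupp /= /g0; case: ifP => [/set_mem//|]; rewrite eqxx.
  have [||m [Sm mx] mP] := supp_wo (H x) (S `&` [set y | y <= x]).
  - by move=> y [Sy yx]; rewrite /fsupp /= -g0H //; exact: Sg.
  - by exists x; split => //=.
  exists m => // y Sy; have [yx|/ltW xy] := og_leP y x; first exact: mP.
  exact: le_trans xy.
pose g := Hahn g0_wo; exists g.
have gI x : I x -> (T g) x = g x.
  move=> Ix; rewrite (cT g (H x)); last by move=> y /ltW yx; exact: g0H Ix yx.
  by rewrite HP //= (g0H x).
apply: hahnP => x; apply/eqP/negPn/negP => /diff_min[y [_ /eqP Ny Tgy]].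
apply/Ny/gI; exists (T g) => z zy; apply: cT => w wz.
by apply: Tgy; apply: lt_le_trans zy.
Qed.

(* The relation [f \prec 1], i.e. positive valuation; holds for [f = 0]. *)
Definition infinitesimal (f : hahn) := supp f `<=` [set x | 0 < x].

Lemma infinitesimal_mul (f g h : hahn) x :
  infinitesimal f -> agree_below g h x -> (f * g) x = (f * h) x.
Proof.
move=> f0 gh; rewrite !coefM; apply: eq_fsbigr => y _.
have [->|/f0 y0] := eqVneq (f y) 0; first by rewrite !mul0r.
by rewrite gh // og_ltBl.
Qed.

Lemma hahn_unit (f : hahn) : f != 0 -> exists g, g * f = 1.
Proof.
move=> f0; have [x fx] : exists x, f x != (0 : hahn) x.
  apply: contrapT => Nf; move/eqP: f0; apply; apply: hahnP => x.
  by apply/eqP/negPn/negP => fx; apply: Nf; exists x.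
have {x fx} [x [_ fx fbelow]] := diff_min fx.
pose u := mono (f x)^-1 (- x); pose v := mono (f x) x.
have vu : v * u = 1.
  apply: hahnP => y; rewrite coef_monoM coef1 /=.
  by rewrite subr_eq addrC subrr; case: eqP; rewrite ?divff ?mulr0.
pose T g := u + (1 - u * f) * g.
have e0 : infinitesimal (1 - u * f).
  move=> y; change ((1 - u * f) y != 0 -> 0 < y).
  rewrite coefB coef1 coef_monoM opprK.
  apply: contraNT; rewrite -og_leNgt le_eqVlt => /orP[/eqP->|y0].
    by rewrite eqxx add0r mulVf ?subrr.
  have yx : y + x < x by rewrite addrC -{2}(addr0 x) og_ltD2l.
  by rewrite (lt_eqF y0) (fbelow _ yx) coef0 mulr0 subr0.
have cT : contraction T.
  by move=> g h y gh; rewrite /T !coefD (infinitesimal_mul e0 gh).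
have [g Tg] := contraction_fixpoint cT; exists g.
have : u * (1 - f * g) = 0.
  move: Tg; rewrite /T mulrBl mul1r addrCA => /eqP.
  by rewrite -subr_eq0 addrAC subrr add0r mulrBr mulr1 mulrA => /eqP.
move=> /(congr1 ( *%R v)); rewrite mulrA vu mul1r mulr0 => /eqP.
by rewrite subr_eq0 mulrC => /eqP.
Qed.

Definition hahn_inv (f : hahn) : hahn :=
  if f == 0 then 0 else xget 0 [set g | g * f = 1].

Lemma hahn_mulVf (f : hahn) : f != 0 -> hahn_inv f * f = 1.
Proof.
move=> f0; rewrite /hahn_inv (negPf f0).
exact: (@xgetPex _ 0 [set g | g * f = 1] (hahn_unit f0)).
Qed.

Lemma hahn_inv0 : hahn_inv 0 = 0.
Proof. by rewrite /hahn_inv eqxx. Qed.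

HB.instance Definition _ := GRing.ComNzRing_isField.Build hahn hahn_mulVf hahn_inv0.

Lemma trunc_wo (x : G) (f : hahn) :
  well_ordered (fsupp (fun y => if y < x then f y else 0)).
Proof.
by apply: (well_orderedS _ (supp_wo f)) => y; rewrite /fsupp /=; case: ifP; rewrite ?eqxx.
Qed.
Definition trunc x f := Hahn (@trunc_wo x f).

Definition trunc_closed (E : set hahn) := forall f x, E f -> E (trunc x f).

End HahnSeries.

Arguments supp_wo {k G}.

Definition leibniz (R : pzRingType) (d : R -> R) :=
  forall x y, d (x * y) = d x * y + x * d y.

Section HahnDerivation.
Variables (k : fieldType) (d : {additive k -> k}).
Variables (G : orderedGroupType) (c : {additive G -> k}).
Local Notation H := (hahn k G).

Lemma hder_wo (f : H) : well_ordered (fsupp (fun x => d (f x) + f x * c x)).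
Proof.
apply: (well_orderedS _ (supp_wo f)) => x; rewrite /fsupp /=.
by apply: contraNneq => ->; rewrite raddf0 mul0r addr0.
Qed.
Definition hder (f : H) : H := Hahn (@hder_wo f).

Lemma coef_hder f x : hder f x = d (f x) + f x * c x. Proof. by []. Qed.

Lemma hderB : {morph hder : f g / f - g}.
Proof.
by move=> f g; apply: hahnP => x /=; rewrite raddfB mulrBl opprD addrACA.
Qed.
HB.instance Definition _ := GRing.isZmodMorphism.Build H H hder hderB.

Lemma hder_supp f : supp (hder f) `<=` supp f.
Proof.
move=> x; rewrite /supp /fsupp /=.
by apply: contraNneq => ->; rewrite raddf0 mul0r addr0.
Qed.

Lemma hder_leibniz : leibniz d -> leibniz hder.
Proof.
move=> dM f g; apply: hahnP => x /=; set X := fiber f g x.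
rewrite !(@convE _ _ _ _ _ X) //; last 2 first.
- by move=> y [fy gy]; split => //; apply: hder_supp.
- by move=> y [fy gy]; split => //; apply: hder_supp.
have finX : finite_set X := fiber_finite f g x.
rewrite !fsbig_finite // raddf_sum mulr_suml -!big_split /=.
apply: eq_bigr => y _; rewrite dM -[in c x](subrK y x) raddfD /=.
by rewrite !mulrDl !mulrDr !mulrA; ring.
Qed.

Definition id_sub_der (a f : H) : H := f - a * hder f.

Lemma id_sub_der_bij (a : H) : infinitesimal a -> bijective (id_sub_der a).
Proof.
move=> a0.
have cT f : contraction (fun g => f + a * hder g).
  move=> g h x gh; rewrite !coefD; congr (_ + _).
  apply: infinitesimal_mul => // y yx.
  by rewrite !coef_hder gh.
have inj : injective (id_sub_der a).
  move=> g h gh; apply: (contraction_uniq (cT (id_sub_der a h))).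
    by rewrite -gh subrK.
  by rewrite subrK.
have surj f : exists g, id_sub_der a g = f.
  have [g Tg] := contraction_fixpoint (cT f); exists g.
  by rewrite /id_sub_der -{1}Tg addrK.
exists (fun f => xget 0 [set g | id_sub_der a g = f]) => f.
  by apply: inj; apply: (@xgetPex _ 0 [set g | id_sub_der a g = id_sub_der a f]); exists f.
exact: (@xgetPex _ 0 [set g | id_sub_der a g = f] (surj f)).
Qed.

(* [(I - a d)^-1]; only meaningful when [I - a d] is bijective, in particular
   for infinitesimal [a]. *)
Definition id_sub_der_inv (a f : H) : H := xget 0 [set g | id_sub_der a g = f].

Lemma id_sub_derK a : infinitesimal a -> cancel (id_sub_der a) (id_sub_der_inv a).
Proof.
move=> a0 f; apply: (bij_inj (id_sub_der_bij a0)).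
by apply: (@xgetPex _ 0 [set g | id_sub_der a g = id_sub_der a f]); exists f.
Qed.

Lemma id_sub_der_invK a : infinitesimal a -> cancel (id_sub_der_inv a) (id_sub_der a).
Proof.
move=> a0 f; have [h _ hK] := id_sub_der_bij a0.
by apply: (@xgetPex _ 0 [set g | id_sub_der a g = f]); exists (h f).
Qed.

Definition diff_subfield (E : set H) :=
  GRing.divring_closed (mem E) /\ forall f, E f -> E (hder f).

Definition inv_op_closed (E : set H) :=
  forall a f, E a -> infinitesimal a -> E f -> E (id_sub_der_inv a f).

Definition inv_op_hull (E : set H) : set H :=
  smallest (fun F => diff_subfield F /\ inv_op_closed F) E.

Lemma inv_op_hull_sub E : E `<=` inv_op_hull E.
Proof. exact: sub_gen_smallest. Qed.

Lemma inv_op_hull_closed E :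
  diff_subfield (inv_op_hull E) /\ inv_op_closed (inv_op_hull E).
Proof.
split; [split; [split|]|].
- by apply/mem_set => F [[[[F1 _ _] _] _] _]; apply/set_mem.
- move=> f g /set_mem Ef /set_mem Eg; apply/mem_set => F CF.
  have [[[[_ FB _] _] _] _] := CF.
  by apply: set_mem; apply: FB; apply: mem_set; [apply: Ef|apply: Eg].
- move=> f g /set_mem Ef /set_mem Eg; apply/mem_set => F CF.
  have [[[[_ _ FM] _] _] _] := CF.
  by apply: set_mem; apply: FM; apply: mem_set; [apply: Ef|apply: Eg].
- move=> f Ef F CF; have [[[_ Fd] _] _] := CF.
  by apply: Fd; apply: Ef.
- move=> a f Ea a0 Ef F CF; have [[_ FI] _] := CF.
  by apply: FI => //; [apply: Ea|apply: Ef].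
Qed.

End HahnDerivation.

(* Main.v *)
Require Import Defs.
From mathcomp Require Import all_boot all_order all_algebra.
From mathcomp Require Import all_classical.

(** The elements of the hull [K] all of whose truncations lie in [K] form a set
    containing [E]; it suffices that this set is itself a differential subfield
    closed under the operators [(I - a d)^-1].  The key point is that if every
    proper truncation of [u] lies in [K], then [(a u)|_g] equals [a' u] modulo
    [K], where [a'] is [a] or a truncation of [a].  For [h = (f^-1)|_g] this
    turns the truncation of [f f^-1 = 1] into [a' h \in K] with [a'] nonzero,
    and for [h = ((I - a d)^-1 f)|_g] it gives [(I - a' d) h \in K] with [a']
    infinitesimal; in both cases [h \in K]. *)

Import Order.TTheory GRing.Theory.
Local Open Scope classical_set_scope.
Local Open Scope ring_scope.

Lemma og_leD (G : orderedGroupType) (a b x y : G) :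
  a <= x -> b <= y -> a + b <= x + y.
Proof.
move=> ax b_y; apply: (@le_trans _ _ (x + b)).
  by rewrite og_leD2r.
by rewrite og_leD2l.
Qed.

(** * Truncations, supports and products *)

Section Truncation.
Context {k : fieldType} {G : orderedGroupType}.
Implicit Types (f g h a u : hahn k G) (x y z : G) (K : set (hahn k G)).

Lemma coef_trunc x f y : trunc x f y = if y < x then f y else 0.
Proof. by []. Qed.

Lemma truncB x f g : trunc x (f - g) = trunc x f - trunc x g.
Proof.
apply: hahnP => y; rewrite Defs.coefB !coef_trunc Defs.coefB.
by case: ifP; rewrite ?subr0.
Qed.

Lemma truncD x f g : trunc x (f + g) = trunc x f + trunc x g.
Proof.
apply: hahnP => y; rewrite Defs.coefD !coef_trunc Defs.coefD.
by case: ifP; rewrite ?addr0.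
Qed.

Lemma trunc_id x f : (forall y, supp f y -> y < x) -> trunc x f = f.
Proof.
move=> fx; apply: hahnP => y; rewrite coef_trunc; case: ifPn => // yx.
by apply/esym/hahn_notin => /fx; apply/negP.
Qed.

Lemma trunc_eq0 x f : (forall y, supp f y -> x <= y) -> trunc x f = 0.
Proof.
move=> fx; apply: hahnP => y; rewrite coef_trunc; case: ifPn => // yx.
by apply: hahn_notin => /fx; rewrite og_leNgt yx.
Qed.

Lemma supp_trunc x f y : supp (trunc x f) y -> supp f y /\ y < x.
Proof. by rewrite /supp /fsupp /=; case: ifP => //; rewrite eqxx. Qed.

Lemma supp_subr_trunc x f y : supp (f - trunc x f) y -> supp f y /\ x <= y.
Proof.
rewrite /supp /fsupp /= og_leNgt.
by case: ifP => _; rewrite ?subrr ?eqxx // subr0.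
Qed.

Lemma trunc_trunc_lt x y f : y < x -> trunc y (trunc x f) = trunc y f.
Proof.
move=> yx; apply: hahnP => z; rewrite !coef_trunc.
by case: ifP => // zy; rewrite (lt_trans zy yx).
Qed.

Lemma supp_mul f g : supp (f * g) `<=` sumset (supp f) (supp g).
Proof. exact: conv_supp. Qed.

(** The part of [g] that is cut off starts at [y] or later, so its product with [f] starts at
    [x + y] or later. *)
Lemma trunc_mul_trunc x y f g : (forall z, supp f z -> x <= z) ->
  trunc (x + y) (f * trunc y g) = trunc (x + y) (f * g).
Proof.
move=> fx; apply/esym/eqP; rewrite -subr_eq0 -truncB -mulrBr; apply/eqP.
apply: trunc_eq0 => _ /supp_mul[z [w [fz /supp_subr_trunc[_ yw] ->]]].
by apply: og_leD => //; exact: fx.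
Qed.

(** Well-founded induction: the cut points range over the well-ordered support of [u], and cutting
    twice is cutting once at the smaller point. *)
Lemma trunc_ind (P : hahn k G -> Prop) :
  (forall u, (forall x, supp u x -> P (trunc x u)) -> P u) -> forall u, P u.
Proof.
move=> step u; apply: (step) => x0 ux0; apply: contrapT => nP.
have [||x [ux Nx] xmin] := supp_wo u [set x | supp u x /\ ~ P (trunc x u)].
- by move=> y [].
- by exists x0.
apply: Nx; apply: step => y /supp_trunc[uy yx].
rewrite trunc_trunc_lt //; apply: contrapT => Ny.
by have := xmin y (conj uy Ny); rewrite og_leNgt yx.
Qed.

(** Moving a cut up to the next support point changes nothing, so the truncations that [trunc_ind]
    meets are, besides [u] itself, all there are. *)
Lemma trunc_proper u x :
  trunc x u = u \/ exists2 y, supp u y & trunc x u = trunc y u.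
Proof.
have [[y [uy xy]]|N] := pselect (exists y, supp u y /\ x <= y); last first.
  left; apply: trunc_id => y uy; rewrite og_ltNge; apply/negP => xy.
  by apply: N; exists y.
right; have [||m [um xm] mmin] := supp_wo u [set y | supp u y /\ x <= y].
- by move=> z [].
- by exists y.
exists m => //; apply: hahnP => z; rewrite !coef_trunc.
have [zx|xz] := boolP (z < x); first by rewrite (lt_le_trans zx xm).
rewrite -og_leNgt in xz; case: ifPn => // zm; apply/esym/hahn_notin => uz.
by have := mmin z (conj uz xz); rewrite og_leNgt zm.
Qed.

(** [f] is listed separately: it is not one of its own truncations when its support is cofinal in
    [G]. *)
Definition hereditary K : set (hahn k G) :=
  [set f | K f /\ forall x, K (trunc x f)].

Lemma hereditary_trunc {K} f x : hereditary K f -> hereditary K (trunc x f).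
Proof.
move=> [_ Kf]; split => // y; have [yx|xy] := boolP (y < x).
  by rewrite trunc_trunc_lt.
rewrite trunc_id // => z /supp_trunc[_ zx].
by rewrite -og_leNgt in xy; exact: lt_le_trans xy.
Qed.

(** * Products and inverses of hereditary elements *)

Section Field.
Context {K : set (hahn k G)}.
Hypothesis KF : GRing.divring_closed (mem K).

Lemma divring_closed_sub f g : K f -> K g -> K (f - g).
Proof.
by case: KF => _ + _ => /(_ f g) KB Kf Kg; apply/set_mem/KB; exact: mem_set.
Qed.

Lemma divring_closed_add f g : K f -> K g -> K (f + g).
Proof.
move=> Kf Kg; rewrite -[g]opprK -(sub0r g) -(subrr f).
by do !apply: divring_closed_sub.
Qed.

Let K1 : K 1. Proof. by case: KF => /set_mem. Qed.

Let Kdiv f g : K f -> K g -> K (f / g).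
Proof.
by case: KF => _ _ /(_ f g) KV Kf Kg; apply/set_mem/KV; exact: mem_set.
Qed.

Let KM f g : K f -> K g -> K (f * g).
Proof.
by move=> Kf Kg; rewrite -[g]invrK -(div1r g); apply: Kdiv => //; exact: Kdiv.
Qed.

Lemma hereditaryB f g : hereditary K f -> hereditary K g -> hereditary K (f - g).
Proof.
move=> [Kf Tf] [Kg Tg].
by split=> [|x]; rewrite ?truncB; exact: divring_closed_sub.
Qed.

(* With [x0] least in [supp a] such that [x0 + y >= x] for some [y] in
   [supp u], and [y0] the least such [y], all of [(trunc x0 a) * u] survives
   and what remains only involves [trunc y0 u]. *)
Lemma trunc_mul_mod_subproof a u x : hereditary K a ->
  (forall b y z, hereditary K b -> supp u y -> K (trunc z (b * trunc y u))) ->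
  exists a', [/\ K a', K (trunc x (a * u) - a' * u)
    & a' = a \/
      exists y z, [/\ supp a y, supp u z, x <= y + z & a' = trunc y a]].
Proof.
move=> Ta Tu.
pose R y z := [/\ supp a y, supp u z & x <= y + z].
have [[y [z Ryz]]|N] := pselect (exists y z, R y z); last first.
  exists a; split; [by case: Ta| |by left].
  rewrite trunc_id ?subrr; first by rewrite -(subrr 1); exact: divring_closed_sub.
  move=> _ /supp_mul[y [z [ay uz ->]]]; rewrite og_ltNge; apply/negP => xyz.
  by apply: N; exists y, z.
have [||x0 [z1 Rxz] x0min] := supp_wo a [set y | exists z, R y z].
- by move=> ? [? []].
- by exists y, z.
have [||y0 [ax0 uy0 xy0] y0min] := supp_wo u (R x0).
- by move=> ? [].
- by exists z1.
exists (trunc x0 a); split; [by case: Ta| |by right; exists x0, y0].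
have -> : trunc x (a * u) - trunc x0 a * u =
    trunc x ((a - trunc x0 a) * trunc y0 u).
  have {1}-> : a * u = trunc x0 a * u + (a - trunc x0 a) * trunc y0 u
      + (a - trunc x0 a) * (u - trunc y0 u).
    rewrite -addrA -mulrDr (addrC (trunc y0 u)) subrK.
    by rewrite -mulrDl (addrC (trunc x0 a)) subrK.
  rewrite !truncD (trunc_id x (trunc x0 a * u)); last first.
    move=> _ /supp_mul[v [w [/supp_trunc[av vx0] uw ->]]].
    rewrite og_ltNge; apply/negP => xvw.
    suff : x0 <= v by rewrite og_leNgt vx0.
    by apply: x0min; exists w.
  rewrite (trunc_eq0 x (_ * (u - _))) ?addr0; first by rewrite addrC addKr.
  move=> _ /supp_mul[v [w [/supp_subr_trunc[av vx0] /supp_subr_trunc[uw wy0] ->]]].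
  by apply: (le_trans xy0); exact: og_leD.
by apply: Tu => //; apply: hereditaryB => //; exact: hereditary_trunc.
Qed.

(** Induction on [u], with [a] kept general: the induction hypothesis has to serve all left factors
    [b] of [trunc_mul_mod_subproof]. *)
Lemma hereditary_trunc_mul u : hereditary K u ->
  forall a x, hereditary K a -> K (trunc x (a * u)).
Proof.
elim/trunc_ind: u => u IH Tu a x Ta.
have [|a' [Ka' Kr _]] := trunc_mul_mod_subproof a u x Ta.
  by move=> b y z Tb uy; apply: IH => //; exact: hereditary_trunc.
rewrite -(subrK (a' * u) (trunc _ _)); apply: divring_closed_add => //.
by apply: KM => //; case: Tu.
Qed.

(** Meant for a [u] not yet known to lie in [K]: its truncations at support points are hereditary,
    since their truncations are again of this kind. *)
Lemma trunc_mul_mod a u x : hereditary K a ->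
  (forall y, supp u y -> K (trunc y u)) ->
  exists a', [/\ K a', K (trunc x (a * u) - a' * u)
    & a' = a \/
      exists y z, [/\ supp a y, supp u z, x <= y + z & a' = trunc y a]].
Proof.
move=> Ta Ku; apply: trunc_mul_mod_subproof => // b y z Tb uy.
apply: hereditary_trunc_mul => //; split; first exact: Ku.
move=> w; have [->|[v /supp_trunc[uv vy] ->]] := trunc_proper (trunc y u) w.
  exact: Ku.
by rewrite trunc_trunc_lt //; exact: Ku.
Qed.

(** Induction that stays among the truncations of [g], as cutting one of them at a point of its
    support gives another. *)
Lemma trunc_closed_ind g :
  (forall x, (forall y, supp (trunc x g) y -> K (trunc y (trunc x g))) ->
    K (trunc x g)) ->
  forall x, K (trunc x g).
Proof.
move=> step x.
suff H : forall h, (exists x, h = trunc x g) -> K h by apply: H; exists x.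
move=> {x} h; elim/trunc_ind: h => h IH [x hx]; rewrite hx in IH *.
apply: step => y uy; apply: IH => //; exists y.
by case/supp_trunc: uy => _ yx; rewrite trunc_trunc_lt.
Qed.

Lemma hereditary1 : hereditary K 1.
Proof.
split => // x; have [x0|x0] := boolP (0 < x).
  rewrite trunc_id // => y; rewrite /supp /fsupp /=.
  by case: (y =P 0) => [->//|_]; rewrite eqxx.
rewrite trunc_eq0; first by rewrite -(subrr 1); exact: divring_closed_sub.
move=> y; rewrite /supp /fsupp /=.
by case: (y =P 0) => [->|_]; rewrite ?eqxx // og_leNgt.
Qed.

Lemma hereditaryM f g : hereditary K f -> hereditary K g -> hereditary K (f * g).
Proof.
move=> Tf Tg; split=> [|x]; last exact: hereditary_trunc_mul.
by apply: KM; [case: Tf|case: Tg].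
Qed.

Lemma hereditaryV f : hereditary K f -> hereditary K f^-1.
Proof.
move=> Tf; have [->|f0] := eqVneq f 0.
  by rewrite invr0 -(subrr 1); apply: hereditaryB; exact: hereditary1.
split; first by rewrite -div1r; apply: Kdiv => //; case: Tf.
have [v fv vmin] : exists2 v, supp f v & lbound (supp f) v.
  apply: (supp_wo f (supp f)) => [y //|]; apply/set0P/eqP => sf0; move/eqP: f0; apply.
  by apply: hahnP => y; apply: hahn_notin; rewrite sf0.
apply: trunc_closed_ind => x Kh; set h := trunc x f^-1 in Kh *.
have [a' [Ka' Kr a'P]] := trunc_mul_mod f h (v + x) Tf Kh.
(* If [a'] is [f] cut at [y], then [z < x] and [v + x <= y + z] force [v < y], so the leading term
   of [f] survives. *)
have a'0 : a' != 0.
  have [->//|[y [z [_ /supp_trunc[_ zx] vyz ->]]]] := a'P.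
  suff vy : v < y.
    apply/eqP => /(congr1 (fun h : hahn k G => h v)); rewrite coef_trunc vy => fv0.
    by move: fv; rewrite /supp /fsupp /= fv0 Defs.coef0 eqxx.
  rewrite og_ltNge; apply/negP => yv; move: vyz; rewrite og_leNgt => /negP; apply.
  by apply: (@le_lt_trans _ _ (v + z)); rewrite ?og_leD2r ?og_ltD2l.
(* Cutting the inverse at [x] affects its product with [f] only from [v + x] on; hence the choice of
   that point. *)
have e : trunc (v + x) (f * h) = trunc (v + x) 1.
  by rewrite trunc_mul_trunc ?divff.
rewrite e in Kr.
have -> : h = (a' * h) / a' by rewrite mulrC mulKf.
apply: Kdiv => //; rewrite -[a' * h](subKr (trunc (v + x) 1)).
by apply: divring_closed_sub => //; exact: (hereditary1.2).
Qed.

End Field.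
End Truncation.

(** * The derivation and the operators [(I - a d)^-1] *)

Section Derivation.
Context {k : fieldType} (d : {additive k -> k}).
Context {G : orderedGroupType} (c : {additive G -> k}).
Context {K : set (hahn k G)}.
Hypothesis KF : diff_subfield d c K.

Lemma trunc_hder x (f : hahn k G) : trunc x (hder d c f) = hder d c (trunc x f).
Proof.
apply: hahnP => y; rewrite coef_hder !coef_trunc coef_hder.
by case: ifP => // _; rewrite raddf0 mul0r addr0.
Qed.

Lemma hereditary_hder f : hereditary K f -> hereditary K (hder d c f).
Proof.
case: KF => _ Kd [Kf Tf]; split; first exact: Kd.
by move=> x; rewrite trunc_hder; exact: Kd.
Qed.

Lemma hereditary_id_sub_der_inv a f : inv_op_closed d c K ->
  hereditary K a -> infinitesimal a -> hereditary K f ->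
  hereditary K (id_sub_der_inv d c a f).
Proof.
move=> KI Ta a0 Tf; case: KF => Kfield Kd.
split; first by apply: KI => //; [case: Ta|case: Tf].
have gE := id_sub_der_invK d c a0 f; set g := id_sub_der_inv d c a f in gE *.
apply: trunc_closed_ind => x Kh; set h := trunc x g in Kh *.
(* [hder] commutes with truncation and does not enlarge supports, so what is known of [h] passes to
   its derivative. *)
have [|a' [Ka' Kr a'P]] := trunc_mul_mod Kfield a (hder d c h) x Ta.
  by move=> y /hder_supp hy; rewrite trunc_hder; apply: Kd; exact: Kh.
have a'0 : infinitesimal a'.
  have [->//|[y [z [_ _ _ ->]]]] := a'P.
  by move=> w /supp_trunc[/a0].
rewrite -(id_sub_derK d c a'0 h); apply: KI => //.
have -> : id_sub_der d c a' h =
    trunc x f + (trunc x (a * hder d c h) - a' * hder d c h).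
  (* As [a] has positive support, cutting [g] at [x] leaves this product unchanged below [x]. *)
  have -> : trunc x (a * hder d c h) = trunc x (a * hder d c g).
    have := trunc_mul_trunc 0 x a (hder d c g); rewrite add0r trunc_hder.
    by apply=> z /a0; exact: ltW.
  by rewrite -gE /id_sub_der truncB addrA subrK.
by apply: (divring_closed_add Kfield) => //; case: Tf.
Qed.

End Derivation.

Theorem theorem5p5 (k : fieldType) (d : {additive k -> k}) (d_leibniz : leibniz d)
    (G : orderedGroupType) (c : {additive G -> k}) (E : set (hahn k G)) :
  diff_subfield d c E -> trunc_closed E -> trunc_closed (inv_op_hull d c E).
Proof.
move=> _ tE f x Kf.
have [KF KI] := inv_op_hull_closed d c E; have Kfield := KF.1.
suff : hereditary (inv_op_hull d c E) f by case.
(* An element of the hull lies in every closed set containing [E]; this is used for the set of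
   hereditary elements. *)
apply: Kf; split; [split; [split; [split|]|]|].
- exact/mem_set/hereditary1.
- by move=> g h /set_mem Tg /set_mem Th; apply/mem_set/hereditaryB.
- move=> g h /set_mem Tg /set_mem Th; apply/mem_set/hereditaryM => //.
  exact: hereditaryV.
- by move=> g; exact: hereditary_hder.
- by move=> a g Ta a0 Tg; exact: hereditary_id_sub_der_inv.
- by move=> g Eg; split=> [|y]; apply: inv_op_hull_sub => //; exact: tE.
Qed.
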